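(* Let $V$ be a real separable Banach space with dual $V'$, and let $\mathcal{A}:D(\mathcal{A})\to 2^{V}$ be a densely defined m-accretive operator whose associated semigroup $T_{\mathcal{A}}$ is domain invariant and admits an infinitesimal generator $\mathcal{A}^{\circ}:V\to V$. Let $V^{\ast}\subseteq V'$ be a set that separates points, $\eta_1,\eta_2\in\mathcal{M}((0,\infty)\times Z\times\Omega;V)$ and $x_1,x_2\in\mathcal{M}(\Omega;V)$. Assume that $X_i:[0,\infty)\times\Omega\to V$ is a mild solution of (ACPRM)$\{x_i,\eta_i,V^{\ast}\}$ for $i=1,2$. Then, almost surely, $$\|X_1(t)-X_2(t)\|_{V}\le\|x_1-x_2\|_{V}+\int_{(0,t]\times Z}\|\eta_1(\tau,z)-\eta_2(\tau,z)\|_{V}\,N_{\Theta}(d\tau\otimes z)\quad\text{for all }t\ge0.$$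
   Context: **Point processes.** $(\Omega,\mathcal{F},\mathbb{P})$ is a complete probability space and $(Z,\mathcal{Z})$ a measurable space; $\mathfrak{B}(\cdot)$ denotes Borel $\sigma$-algebras. A point function is a map $\theta:D(\theta)\to Z$ with $D(\theta)\subseteq(0,\infty)$ countable; $\pi(Z)$ is the set of all point functions, with the $\sigma$-algebra $\Pi(Z)$ generated by the sets $\{\theta\in\pi(Z):\#\{t\in D(\theta):(t,\theta(t))\in U\}=k\}$, $k\in\mathbb{N}_{0}$, $U\in\mathfrak{B}((0,\infty))\otimes\mathcal{Z}$. A point process is an $\mathcal{F}$-$\Pi(Z)$-measurable map $\Theta:\Omega\to\pi(Z)$; its counting measure is $N_{\Theta}(U,\omega)=\#\{t\in D(\Theta(\omega)):(t,\Theta(\omega)(t))\in U\}$. $\Theta$ is finite if $\mathbb{E}N_{\Theta}((0,t]\times Z)<\infty$ for all $t>0$. A finite point process $\Theta$, with $D(\Theta(\omega))$ infinite for a.e. $\omega$, is fixed. Its hitting times are the a.s. unique measurable $\alpha_{m}:\Omega\to(0,\infty)$, $m\in\mathbb{N}$, with, almost surely, $D(\Theta)=\{\alpha_{1},\alpha_{2},\dots\}$ and $0<\alpha_{1}<\alpha_{2}<\cdots$ (then $\alpha_{m}\to\infty$ a.s.); $\alpha_{0}:=0$. Integrals against $N_{\Theta}$ are pathwise (for a.e. $\omega$) Lebesgue integrals w.r.t. $N_{\Theta}(\cdot,\omega)$. **Function spaces.** $\mathcal{M}(\Omega;V)$ is the set of $\mathcal{F}$-$\mathfrak{B}(V)$-measurable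 maps $\Omega\to V$; $\mathcal{M}((0,\infty)\times Z\times\Omega;V)$ is the set of $\mathfrak{B}((0,\infty))\otimes\mathcal{Z}\otimes\mathcal{F}$-$\mathfrak{B}(V)$-measurable maps. $\langle\cdot,\cdot\rangle_{V}$ is the duality between $V$ and $V'$. $V^{\ast}\subseteq V'$ separates points if $\langle\Phi,v\rangle_{V}=0$ for all $\Phi\in V^{\ast}$ implies $v=0$. $W^{1,1}([a,b];V)$ is the set of $f:[a,b]\to V$ that are absolutely continuous and differentiable a.e. **Operators and semigroups.** A multi-valued operator $\mathcal{A}:V\to 2^{V}$ has $D(\mathcal{A})=\{v:\mathcal{A}v\ne\emptyset\}$ and is identified with its graph $\{(v,\hat v):\hat v\in\mathcal{A}v\}$. It is accretive if $\|v_1-v_2\|_V\le\|v_1-v_2+\alpha(\hat v_1-\hat v_2)\|_V$ for all $\alpha>0$, $(v_i,\hat v_i)\in\mathcal{A}$; m-accretive if moreover $R(\mathrm{Id}+\alpha\mathcal{A})=V$ for all $\alpha>0$; densely defined if $\overline{D(\mathcal{A})}=V$. For $\mathcal{A}$ m-accretive and densely defined, $T_{\mathcal{A}}(\cdot)v:[0,\infty)\to V$ is the unique mild solution (in the usual sense of nonlinear semigroup theory, i.e. limit of implicit Euler schemes; equivalently $T_{\mathcal{A}}(t)v=\lim_{n}(\mathrm{Id}+\frac{t}{n}\mathcal{A})^{-n}v$) of $0\in u'(t)+\mathcal{A}u(t)$, $u(0)=v$; $(T_{\mathcal{A}}(t))_{t\ge0}$ is the semigroup associated to $\mathcal{A}$.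 $T_{\mathcal{A}}$ is domain invariant if $T_{\mathcal{A}}(t)v\in D(\mathcal{A})$ for all $t>0$, $v\in V$. $T_{\mathcal{A}}$ admits the infinitesimal generator $\mathcal{A}^{\circ}:V\to V$ if $-\lim_{h\searrow0}\frac{T_{\mathcal{A}}(h)v-v}{h}=\mathcal{A}^{\circ}v\in\mathcal{A}v$ for all $v\in D(\mathcal{A})$, and $\mathcal{A}^{\circ}v=0$ for $v\notin D(\mathcal{A})$. **Solutions.** (ACPRM) is the formal inclusion $\eta(t,z)N_{\Theta}(dt\otimes z)\in dX(t)+\mathcal{A}X(t)dt$. A $\mathfrak{B}([0,\infty))\otimes\mathcal{F}$-$\mathfrak{B}(V)$-measurable process $X:[0,\infty)\times\Omega\to V$ is a strong solution of (ACPRM)$\{x,\eta,V^{\ast}\}$ if for $\mathbb{P}$-a.e. $\omega$: (i) $X(0,\omega)=x(\omega)$; (ii) $t\mapsto X(t,\omega)$ is càdlàg; (iii) $X(t,\omega)\in D(\mathcal{A})$ for all $t\in(0,\infty)\setminus\{\alpha_m(\omega):m\in\mathbb{N}\}$; (iv) for all $m\in\mathbb{N}_0$ and $[a,b]\subseteq(\alpha_m(\omega),\alpha_{m+1}(\omega))$, $X(\cdot,\omega)|_{[a,b]}\in W^{1,1}([a,b];V)$; (v) $\langle\Psi,\mathcal{A}^{\circ}X(\cdot,\omega)\rangle_V\in L^1(0,t)$ for all $t>0$, $\Psi\in V^{\ast}$; (vi) $\langle\Psi,X(t,\omega)-x(\omega)\rangle_V+\int_0^t\langle\Psi,\mathcal{A}^{\circ}X(\tau,\omega)\rangle_Vd\tau=\int_{(0,t]\times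 Z}\langle\Psi,\eta(\tau,z,\omega)\rangle_VN_{\Theta}(d\tau\otimes z,\omega)$ for all $t>0$, $\Psi\in V^{\ast}$. A $\mathfrak{B}([0,\infty))\otimes\mathcal{F}$-$\mathfrak{B}(V)$-measurable process $Y$ is a mild solution of (ACPRM)$\{x,\eta,V^{\ast}\}$ if it satisfies (i)-(iv) a.s. and there are $x_m\in\mathcal{M}(\Omega;V)$, $\eta_m\in\mathcal{M}((0,\infty)\times Z\times\Omega;V)$ and strong solutions $X_m$ of (ACPRM)$\{x_m,\eta_m,V^{\ast}\}$ ($m\in\mathbb{N}$) such that almost surely, for all $t>0$, $\lim_m\sup_{\tau\in[0,t]}\|X_m(\tau)-Y(\tau)\|_V=0$ and $\lim_m\int_{(0,t]\times Z}\|\eta_m(\tau,z)-\eta(\tau,z)\|_VN_{\Theta}(d\tau\otimes z)=0$. *)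

(* Defs.v *)
From HB Require Import structures.
From mathcomp Require Import all_boot all_order all_algebra.
From mathcomp Require Import all_classical all_reals all_analysis.

Set Implicit Arguments.
Unset Strict Implicit.
Unset Printing Implicit Defensive.
Import Order.TTheory GRing.Theory Num.Theory.
Import numFieldNormedType.Exports.
Local Open Scope classical_set_scope.
Local Open Scope ring_scope.

Definition separable (T : topologicalType) :=
  exists2 S : set T, countable S & dense S.

(* Borel sets of a topological space that carries no measurable structure *)
Definition borel (V : ptopologicalType) := g_sigma_algebraType (@open V).

Definition pf_dom (R : realType) (Z : Type) (f : R -> option Z) : set R :=
  [set t | f t <> None].

(* A partial function: [pf_map theta t = None] encodes that t is outside the
   domain of theta, so that two point functions are equal iff they have the same
   domain and agree on it. *)
Record point_function (R : realType) (Z : Type) := PointFunction {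
  pf_map :> R -> option Z ;
  pf_pos : pf_dom pf_map `<=` `]0, +oo[ ;
  pf_countable : countable (pf_dom pf_map) }.

Section point_function_pointed.
Context (R : realType) (Z : Type).

Let dom0 : pf_dom (fun=> None : option Z) = set0 :> set R.
Proof. by rewrite -subset0 => t. Qed.

Definition pf_empty : point_function R Z.
Proof.
exists (fun=> None); rewrite dom0; [exact: sub0set|exact: countable0].
Defined.

HB.instance Definition _ := gen_eqMixin (point_function R Z).
HB.instance Definition _ := gen_choiceMixin (point_function R Z).
HB.instance Definition _ := isPointed.Build (point_function R Z) pf_empty.

End point_function_pointed.

Section counting_measure.
Context (R : realType) (d : measure_display) (Z : measurableType d).
Implicit Types (theta : point_function R Z) (U : set (R * Z)).

Definition pf_times theta U : set R :=
  [set t | exists2 z, theta t = Some z & U (t, z)].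

Definition pf_count theta U : \bar R := counting (pf_times theta U).

Let pf_times_measurable theta U : measurable (pf_times theta U).
Proof.
apply: countable_measurable; first by move=> t; exact: measurable_set1.
apply: sub_countable (pf_countable theta).
by apply: subset_card_le => t [z tz _]; rewrite /pf_dom/= tz.
Qed.

Let pf_count0 theta : pf_count theta set0 = 0%E.
Proof.
rewrite /pf_count (_ : pf_times _ _ = set0) ?measure0//.
by rewrite -subset0 => t [].
Qed.

Let pf_count_ge0 theta U : (0 <= pf_count theta U)%E.
Proof. exact: measure_ge0. Qed.

Let pf_count_sigma_additive theta : semi_sigma_additive (pf_count theta).
Proof.
move=> F mF tF mUF; rewrite /pf_count.
have -> : pf_times theta (\bigcup_i F i) = \bigcup_i pf_times theta (F i).
  apply/seteqP; split=> t.
    by move=> [z tz [i _ Fi]]; exists i => //; exists z.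
  by move=> [i _ [z tz Fi]]; exists z => //; exists i.
apply: (@measure_semi_sigma_additive _ _ _ (@counting R R)) => //.
- move=> i j _ _ [t [[z tz Fi] [z' tz' Fj]]]; apply: tF => //.
  by exists (t, z); split=> //; move: tz' Fj; rewrite tz => -[<-].
- exact: bigcup_measurable.
Qed.

HB.instance Definition _ theta := isMeasure.Build _ _ _ (pf_count theta)
  (pf_count0 theta) (pf_count_ge0 theta) (@pf_count_sigma_additive theta).

(* The sets U range over the product sigma-algebra on ]0, +oo[ * Z, seen as the
   measurable subsets of R * Z contained in ]0, +oo[ * Z. *)
Definition pf_generators : set (set (point_function R Z)) :=
  [set B | exists (k : nat) (U : set (R * Z)),
     [/\ measurable U, U `<=` `]0, +oo[%classic `*` setT &
         B = [set theta | pf_count theta U = k%:R%:E]]].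

End counting_measure.

Section point_process.
Context (R : realType) (dZ : measure_display) (Z : measurableType dZ).
Context (dO : measure_display) (Omega : measurableType dO).
Variable P : probability Omega R.
Implicit Types (Theta : Omega -> point_function R Z) (alpha : nat -> Omega -> R).

Definition point_process Theta :=
  measurable_fun setT (Theta : Omega -> g_sigma_algebraType (@pf_generators R _ Z)).

Definition finite_point_process Theta :=
  point_process Theta /\
  forall t : R, 0 < t ->
    (\int[P]_w pf_count (Theta w) (`]0%R, t] `*` setT) < +oo)%E.

(* [alpha 0 = 0] is a convention: the hitting times are the [alpha m.+1]. *)
Definition hitting_times Theta alpha :=
  [/\ forall w, alpha 0%N w = 0,
      forall m, measurable_fun setT (alpha m.+1),
      forall m w, 0 < alpha m.+1 w &
      {ae P, forall w, pf_dom (Theta w) = [set alpha m.+1 w | m in [set: nat]] /\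
                       forall m, alpha m w < alpha m.+1 w}].

End point_process.

Section operators.
Context (R : realType) (V : normedModType R).
Implicit Types (A : V -> set V) (T : R -> V -> V).

Definition op_dom A : set V := [set v | A v !=set0].

Definition accretive A := forall (a : R) (v1 v2 w1 w2 : V),
  0 < a -> A v1 w1 -> A v2 w2 ->
  `|v1 - v2| <= `|v1 - v2 + a *: (w1 - w2)|.

Definition m_accretive A := accretive A /\
  forall a : R, 0 < a -> \bigcup_v [set v + a *: w | w in A v] = [set: V].

Definition densely_defined A := closure (op_dom A) = [set: V].

(* An eps-approximate solution on [0, b] of 0 \in u' + A u, u(0) = v : values z_i
   at times 0 = s_0 < ... < s_N of the implicit Euler scheme
   f_i \in (z_i - z_{i-1}) / (s_i - s_{i-1}) + A z_i with small errors f_i. *)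
Definition euler_scheme A (v : V) (b eps : R)
    (N : nat) (s : nat -> R) (f z : nat -> V) :=
  [/\ s 0%N = 0,
      forall i, (i < N)%N -> 0 < s i.+1 - s i < eps,
      b - eps < s N <= b,
      forall i, (i < N)%N ->
        A (z i.+1) (f i.+1 - (s i.+1 - s i)^-1 *: (z i.+1 - z i)) &
      \sum_(i < N) (s i.+1 - s i) * `|f i.+1| < eps /\ `|z 0%N - v| <= eps].

(* Mild solution of 0 \in u' + A u, u(0) = v, in the sense of Benilan, Crandall
   and Pazy. Only the values of u on [0, +oo[ matter. *)
Definition mild_solution A (v : V) (u : R -> V) :=
  [/\ u 0 = v,
      {within `[0, +oo[, continuous u} &
      forall b eps : R, 0 < b -> 0 < eps -> exists N s f z,
        euler_scheme A v b eps N s f z /\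
        forall i t, (i < N)%N -> s i < t <= s i.+1 -> `|u t - z i.+1| <= eps].

Definition associated_semigroup A T := forall v, mild_solution A v (T ^~ v).

Definition domain_invariant A T := forall t v, 0 < t -> op_dom A (T t v).

Definition infinitesimal_generator A T (A0 : V -> V) :=
  (forall v, op_dom A v ->
     - (h^-1 *: (T h v - v)) @[h --> 0^'+] --> A0 v /\ A v (A0 v)) /\
  (forall v, ~ op_dom A v -> A0 v = 0).

Definition dual : set {linear V -> R^o} :=
  [set Psi : {linear V -> R^o} | continuous Psi].

Definition separates_points (Vs : set {linear V -> R^o}) :=
  forall v : V, (forall Psi, Vs Psi -> Psi v = 0) -> v = 0.

(* Only the values of f on [a, b] matter in [absolutely_continuous] and [W11]. *)
Definition absolutely_continuous (a b : R) (f : R -> V) :=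
  forall eps : R, 0 < eps -> exists2 delta : R, 0 < delta &
    forall (n : nat) (l r : 'I_n -> R),
      (forall i, a <= l i /\ l i <= r i /\ r i <= b) ->
      trivIset setT (fun i => `]l i, r i[%classic) ->
      \sum_(i < n) (r i - l i) < delta ->
      \sum_(i < n) `|f (r i) - f (l i)| < eps.

Definition W11 (a b : R) (f : R -> V) :=
  absolutely_continuous a b f /\
  {ae lebesgue_measure, forall t, t \in `]a, b[ -> derivable f t 1}.

Definition cadlag (f : R -> V) :=
  (forall t, 0 <= t -> f @ t^'+ --> f t) /\
  (forall t, 0 < t -> cvg (f @ t^'-)).

End operators.

Section solutions.
Context (R : realType) (dZ : measure_display) (Z : measurableType dZ).
Context (dO : measure_display) (Omega : measurableType dO).
Context (V : completeNormedModType R).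
Variables (P : probability Omega R) (Theta : Omega -> point_function R Z).
Variables (alpha : nat -> Omega -> R) (A : V -> set V) (A0 : V -> V).
Variable Vs : set {linear V -> R^o}.

Definition measurable_initial (x : Omega -> V) :=
  measurable_fun setT (x : Omega -> borel V).

Definition measurable_noise (eta : R -> Z -> Omega -> V) :=
  measurable_fun (`]0, +oo[ `*` setT `*` setT : set (R * Z * Omega))
    ((fun q => eta q.1.1 q.1.2 q.2) : R * Z * Omega -> borel V).

Definition measurable_process (X : R -> Omega -> V) :=
  measurable_fun (`[0, +oo[ `*` setT : set (R * Omega))
    ((fun q => X q.1 q.2) : R * Omega -> borel V).

Definition solution_path (x : Omega -> V) (X : R -> Omega -> V) (w : Omega) :=
  [/\ X 0 w = x w,
      cadlag (X ^~ w),
      forall t, 0 < t -> (forall m, t <> alpha m.+1 w) -> op_dom A (X t w) &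
      forall m (a b : R), a <= b ->
        `[a, b]%classic `<=` `]alpha m w, alpha m.+1 w[%classic ->
        W11 a b (X ^~ w)].

Definition ACPRM_strong_solution (x : Omega -> V) (eta : R -> Z -> Omega -> V)
    (X : R -> Omega -> V) :=
  measurable_process X /\
  {ae P, forall w,
    [/\ solution_path x X w,
        forall t Psi, 0 < t -> Vs Psi ->
          lebesgue_measure.-integrable `]0, t[ (fun s => (Psi (A0 (X s w)))%:E) &
        forall t Psi, 0 < t -> Vs Psi ->
          ((Psi (X t w - x w))%:E +
             \int[lebesgue_measure]_(s in `]0%R, t[) (Psi (A0 (X s w)))%:E =
           \int[pf_count (Theta w)]_(q in `]0%R, t] `*` setT)
             (Psi (eta q.1 q.2 w))%:E)%E]}.

Definition ACPRM_mild_solution (x : Omega -> V) (eta : R -> Z -> Omega -> V)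
    (Y : R -> Omega -> V) :=
  [/\ measurable_process Y,
      {ae P, forall w, solution_path x Y w} &
      exists (xs : nat -> Omega -> V) (etas : nat -> R -> Z -> Omega -> V)
             (Xs : nat -> R -> Omega -> V),
        [/\ forall m, measurable_initial (xs m),
            forall m, measurable_noise (etas m),
            forall m, ACPRM_strong_solution (xs m) (etas m) (Xs m) &
            {ae P, forall w (t : R), 0 < t ->
              (ereal_sup [set `|Xs m s w - Y s w|%:E | s in `[0%R, t]]
                 @[m --> \oo] --> 0%E) /\
              (\int[pf_count (Theta w)]_(q in `]0%R, t] `*` setT)
                 `|etas m q.1 q.2 w - eta q.1 q.2 w|%:E
                 @[m --> \oo] --> 0)%E}]].

End solutions.

(* Main.v *)
(* Between two hitting times a strong solution satisfies [X' = - A0 X] almost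
   everywhere: a countable subset of [Vs] already separates points, and for each
   functional of it Lebesgue's differentiation theorem applies to the integral
   equation. Hence, by accretivity, the distance of two strong solutions, which
   is absolutely continuous, has nonpositive left derivative almost everywhere,
   and so decreases between hitting times; at [alpha m.+1] it grows by at most
   the distance of the jumps, which the same equation identifies with the values
   of the noises. As the counting measure is almost surely finite on bounded
   intervals, integrals against it are finite sums, and induction on the hitting
   times gives the bound for strong solutions; it passes to the limit defining
   mild solutions. *)
Require Import Defs.
From mathcomp Require Import all_boot all_order all_algebra.
From mathcomp Require Import all_classical all_reals all_analysis measurable_realfun.
From mathcomp Require Import lra.
Set Implicit Arguments.
Unset Strict Implicit.
Unset Printing Implicit Defensive.
Import Order.TTheory GRing.Theory Num.Theory.
Import numFieldNormedType.Exports.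
Local Open Scope classical_set_scope.
Local Open Scope ring_scope.

(** * Absolutely continuous real functions with nonpositive left derivative *)

Section absolutely_continuous_monotonicity.
Context (R : realType) (a b : R) (g : R -> R^o).
Implicit Types (U : set R) (x y s : R).

(** The supremum of this set is the variation of [g] inside [U] up to [x]; it controls [g] where
    nothing is known about its derivative. *)
Definition variations U x : set R :=
  [set s | exists (n : nat) (l r : nat -> R),
    [/\ forall i, (i < n)%N ->
          [/\ a <= l i, l i <= r i, r i <= x & `]l i, r i[%classic `<=` U],
        trivIset `I_n (fun i => `]l i, r i[%classic) &
        s = \sum_(i < n) `|g (r i) - g (l i)|]].

Lemma variations0 U x : variations U x 0.
Proof.
exists 0%N, (fun=> 0), (fun=> 0); split => //; last by rewrite big_ord0.
Qed.

Lemma subset_variations U x y : x <= y -> variations U x `<=` variations U y.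
Proof.
move=> xy s [n [l [r [lr tI ->]]]]; exists n, l, r; split => // i /lr[? ? rx ?].
by split => //; exact: le_trans xy.
Qed.

(** The interval from [x] to [y] is appended to the family: all its members end by [x], so
    disjointness persists. *)
Lemma variationsD U x y s : a <= x -> x <= y -> `]x, y[%classic `<=` U ->
  variations U x s -> variations U y (s + `|g y - g x|).
Proof.
move=> ax xy xyU [n [l [r [lr tI ->]]]].
exists n.+1, (fun i => if (i == n)%N then x else l i),
  (fun i => if (i == n)%N then y else r i); split.
- move=> i; rewrite ltnS leq_eqVlt => /predU1P[->|iN]; first by rewrite eqxx.
  rewrite ltn_eqF//; have [? ? rx ?] := lr _ iN.
  by split => //; exact: le_trans xy.
- have disj i z : (i < n)%N -> `]l i, r i[%classic z -> `]x, y[%classic z -> False.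
    move=> iN /=; rewrite !in_itv/= => /andP[_ zr] /andP[xz _].
    have [_ _ rx _] := lr _ iN.
    by move: (lt_trans xz zr); rewrite ltNge rx.
  move=> i j /=; rewrite !ltnS [(i <= n)%N]leq_eqVlt [(j <= n)%N]leq_eqVlt.
  move=> /predU1P[->|iN] /predU1P[->|jN] //.
  + rewrite eqxx ltn_eqF// => -[z [z1 z2]].
    by have := disj _ _ jN z2 z1.
  + rewrite eqxx ltn_eqF// => -[z [z1 z2]].
    by have := disj _ _ iN z1 z2.
  + by rewrite !ltn_eqF// => z; exact: tI.
- rewrite big_ord_recr/= eqxx; congr (_ + _).
  by apply: eq_bigr => i _; rewrite ltn_eqF.
Qed.

(** Disjoint intervals inside [U] have total length at most the measure of [U], which is below
    [delta]; absolute continuity then applies. *)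
Lemma variations_lt (eps delta : R) U x s :
  (forall (n : nat) (l r : 'I_n -> R),
      (forall i, a <= l i /\ l i <= r i /\ r i <= b) ->
      trivIset setT (fun i => `]l i, r i[%classic) ->
      \sum_(i < n) (r i - l i) < delta ->
      \sum_(i < n) `|g (r i) - g (l i)| < eps) ->
  measurable U -> (lebesgue_measure U < delta%:E)%E -> x <= b ->
  variations U x s -> s < eps.
Proof.
move=> ac mU Ud xb [n [l [r [lr tI ->]]]].
apply: (ac n (l \o val) (r \o val)) => /=.
- by move=> i; have [? ? rx _] := lr i (ltn_ord i); do 2 split => //; exact: le_trans xb.
- move=> i j _ _ ij; apply/val_inj; apply: tI => //=; exact: ltn_ord.
rewrite -lte_fin; apply: le_lt_trans Ud.
rewrite -sumEFin.
rewrite (eq_bigr (fun i : 'I_n => lebesgue_measure `]l i, r i[%classic)); last first.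
  move=> i _; rewrite lebesgue_measure_itv/= lte_fin.
  have [_ + _ _] := lr i (ltn_ord i).
  by rewrite le_eqVlt => /predU1P[->|lri]; [rewrite ltxx subrr|rewrite lri EFinB].
have mlr i : measurable (`]l i, r i[%classic : set R) by exact: measurable_itv.
have := @measure_semi_additive_ord_I _ _ R lebesgue_measure
  (fun i => `]l i, r i[%classic) n (fun i _ => mlr i) tI.
move=> <-; last by apply: bigsetU_measurable => i _.
apply: le_measure; rewrite ?inE//.
  by apply: bigsetU_measurable => i _.
move=> z; rewrite -(bigcup_mkord n (fun i => `]l i, r i[%classic)) => -[i /= iN].
by have [_ _ _ /[apply]] := lr _ iN.
Qed.

(* The null set [N] is covered by an open [U] of small measure; subtracting from
   [g] its variation inside [U] and [eps * x] yields a function that decreases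
   to the left of every point. *)
Lemma absolutely_continuous_nonincreasing (N : set R) :
  a <= b -> absolutely_continuous a b g -> lebesgue_measure.-negligible N ->
  (forall x, a < x <= b -> ~ N x -> forall eps : R, 0 < eps ->
     \forall y \near x^'-, g x - g y <= eps * (x - y)) ->
  g b <= g a.
Proof.
move=> ab acg [M [mM M0 NM]] gN.
(* Of the two errors, [eps] bounds the variation inside [U] and [eps * (b - a)] comes from the slope
   [eps]. *)
suff gE eps : 0 < eps -> g b <= g a + eps * (1 + (b - a)).
  apply/ler_addgt0Pr => e e0.
  have ba : 0 < 1 + (b - a) by rewrite ltr_pwDl// subr_ge0.
  by have := gE (e / (1 + (b - a))) (divr_gt0 e0 ba); rewrite divfK// gt_eqF.
move=> eps0; have [delta delta0 acd] := acg _ eps0.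
have [U [oU MU UMd]] : exists U : set R,
    [/\ open U, M `<=` U & (lebesgue_measure (U `\` M) < delta%:E)%E].
  apply: lebesgue_regularity_outer => //.
  exact: (eq_ind_r (fun z => z < +oo)%E (ltry 0) M0).
have mU : measurable U by exact: open_measurable.
have Ud : (lebesgue_measure U < delta%:E)%E.
  rewrite (le_lt_trans _ UMd)//.
  by rewrite -[in leLHS](setDUK MU) setUC measureU0//; exact: measurableD.
pose V x := sup (variations U x).
have hasV x : x <= b -> has_sup (variations U x).
  move=> xb; split; first by exists 0; exact: variations0.
  by exists eps => s /(variations_lt acd mU Ud xb)/ltW.
have Vge0 x : x <= b -> 0 <= V x.
  by move=> xb; apply: ub_le_sup; [case: (hasV _ xb)|exact: variations0].
have Vle x : x <= b -> V x <= eps.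
  move=> xb; apply: ge_sup; first by exists 0; exact: variations0.
  by move=> s /(variations_lt acd mU Ud xb)/ltW.
have Vmono x y : x <= y -> y <= b -> V x <= V y.
  move=> xy yb; apply: ge_sup; first by exists 0; exact: variations0.
  move=> s /(subset_variations xy) ?; apply: ub_le_sup => //.
  by case: (hasV _ yb).
have VD x y : a <= x -> x <= y -> y <= b -> `]x, y[%classic `<=` U ->
    V x + `|g y - g x| <= V y.
  move=> ax xy yb xyU; rewrite -lerBrDr; apply: ge_sup.
    by exists 0; exact: variations0.
  move=> s /(variationsD ax xy xyU) ?; rewrite lerBrDr; apply: ub_le_sup => //.
  by case: (hasV _ yb).
pose h x := g x - V x - eps * x.
suff hba : h b <= h a.
  by have := Vle _ (lexx b); have := Vge0 _ ab; move: hba; rewrite /h; lra.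
(* Continuous induction from right to left: the infimum [c] of [S] is shown to lie in [S], and
   [a < c] would allow a further step to the left. *)
pose S := [set x | a <= x <= b /\ forall y, x <= y <= b -> h b <= h y].
have Sb : S b.
  split; first by rewrite ab lexx.
  by move=> y yb; have -> : y = b by apply/eqP; rewrite eq_le andbC.
have Slb : lbound S a by move=> x [/andP[]].
have hS : has_inf S by split; [exists b|exists a].
pose c := inf S.
have ac : a <= c by apply: lb_le_inf => //; exists b.
have cb : c <= b by apply: ge_inf => //; exists a.
have hc y : c < y <= b -> h b <= h y.
  move=> /andP[cy yb].
  have [x [_ xS] xy] := inf_lt hS.1 cy.
  by apply: xS; rewrite (ltW xy).
(* [V] is only known to be monotone, but [V c <= V y] is the favourable direction, so continuity of
   [g] at [c] suffices. *)
have hbc : h b <= h c.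
  move: cb; rewrite le_eqVlt => /predU1P[->//|cb].
  apply/ler_addgt0Pr => e e0.
  have [d d0 acd'] := acg _ e0.
  pose y := Num.min b (c + d / 2).
  have cy : c < y by rewrite lt_min cb ltrDl divr_gt0.
  have yb : y <= b by rewrite ge_min lexx.
  have ycd : y - c < d.
    by rewrite ltrBlDl (@le_lt_trans _ _ (c + d / 2)) ?ge_min ?lexx ?orbT//; lra.
  have gyc : `|g y - g c| < e.
    have := acd' 1%N (fun=> c) (fun=> y).
    rewrite !big_ord1; apply => //.
      by move=> _; rewrite ac (ltW cy) yb.
    by move=> i j _ _ _; rewrite (ord1 i) (ord1 j).
  have := hc y; rewrite cy yb => /(_ isT).
  have := Vmono c y (ltW cy) yb.
  have : eps * c <= eps * y by rewrite ler_pM2l// ltW.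
  move: gyc; rewrite ltr_norml => /andP[_]; rewrite /h; lra.
have Sc : S c.
  split; first by rewrite ac.
  move=> y /andP[]; rewrite le_eqVlt => /predU1P[<-//|cy yb].
  by apply: hc; rewrite cy.
move: ac; rewrite le_eqVlt => /predU1P[->//|ac].
have : \forall y \near c^'-, a <= y /\ h c <= h y.
  (* If [c] is in [N], an interval to the left of [c] lies in [U] and the increase of [V] pays for
     that of [g]; otherwise the term [eps * x] pays for it. *)
  have [/NM/MU Uc|Nc] := pselect (N c).
    have /nbhs_ballP[r /= r0 rU] : nbhs c U by exact: open_nbhs_nbhs.
    near=> y; have yc : y < c by near: y; exact: nbhs_left_lt.
    have ay : a <= y by near: y; exact: nbhs_left_ge.
    split => //.
    have /VD : `]y, c[%classic `<=` U.
      move=> z /=; rewrite in_itv/= => /andP[yz zc]; apply: rU => /=.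
      rewrite /ball/= gtr0_norm ?subr_gt0// ltrBlDl -ltrBlDr (lt_trans _ yz)//.
      near: y; apply: nbhs_left_gt; by rewrite ltrBlDr ltrDl.
    move=> /(_ ay (ltW yc) cb).
    have : eps * y <= eps * c by rewrite ler_pM2l// ltW.
    have := ler_norm (g c - g y); rewrite /h; lra.
  have {}gN := gN c; rewrite ac cb in gN; have {}gN := gN isT Nc _ eps0.
  near=> y; have yc : y < c by near: y; exact: nbhs_left_lt.
  have ay : a <= y by near: y; exact: nbhs_left_ge.
  split => //; have := Vmono _ _ (ltW yc) cb.
  have : g c - g y <= eps * (c - y) by near: y.
  by rewrite /h; lra.
rewrite nearE => -[r /= r0 hr].
(* A point of [S] left of [c] contradicts the infimum; half the radius keeps [[y, c[] in the
   neighbourhood, and the maximum keeps [y] in [[a, b]]. *)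
pose y := Num.max a (c - r / 2).
have yc : y < c by rewrite gt_max ac ltrBlDr ltrDl divr_gt0.
have : S y.
  split; first by rewrite le_max lexx (ltW (lt_le_trans yc cb)).
  move=> z /andP[yz zb]; have [cz|zc] := leP c z.
    by have [_] := Sc; apply; rewrite cz.
  apply: (le_trans hbc); apply: (hr z _ zc).2 => /=.
  rewrite gtr0_norm ?subr_gt0//.
  have : c - r / 2 <= z by rewrite (le_trans _ yz)// le_max lexx orbT.
  lra.
move=> /(ge_inf (ex_intro _ a Slb)); rewrite -/c leNgt yc//.
Unshelve. all: by end_near. Qed.

End absolutely_continuous_monotonicity.

(** * Distance of two paths driven by an accretive operator *)

Section accretive_paths.
Context (R : realType) (V : normedModType R) (A : V -> set V).
Implicit Types u v : R -> V.

Lemma absolutely_continuous_dist (a b : R) u v :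
  absolutely_continuous a b u -> absolutely_continuous a b v ->
  absolutely_continuous a b ((fun t => `|u t - v t|) : R -> R^o).
Proof.
move=> acu acv eps eps0.
have e2 : 0 < eps / 2 by rewrite divr_gt0.
have [d1 d10 {}acu] := acu _ e2; have [d2 d20 {}acv] := acv _ e2.
exists (Num.min d1 d2); first by rewrite lt_min d10.
move=> n l r lr tI; rewrite lt_min => /andP[s1 s2].
rewrite [ltRHS]splitr; apply: le_lt_trans (ltrD (acu n l r lr tI s1) (acv n l r lr tI s2)).
rewrite -big_split/=; apply: ler_sum => i _.
apply: le_trans (ler_dist_dist _ _) _.
rewrite (_ : _ - _ - _ = u (r i) - u (l i) - (v (r i) - v (l i))) ?ler_normB//.
by rewrite !opprD !opprK addrACA.
Qed.

(* To first order [u y - v y = u x - v x + (x - y) *: (w1 - w2)] as [y -> x^-],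
   whose norm is at least that of [u x - v x] by accretivity. *)
Lemma accretive_dist_left (u v : R -> V) (x : R) (w1 w2 : V) :
  accretive A -> derivable u x 1 -> derivable v x 1 ->
  'D_1 u x = - w1 -> 'D_1 v x = - w2 -> A (u x) w1 -> A (v x) w2 ->
  forall eps : R, 0 < eps ->
  \forall y \near x^'-, `|u x - v x| - `|u y - v y| <= eps * (x - y).
Proof.
move=> accA du dv Du Dv Aw1 Aw2 eps eps0.
have df : derivable (u - v) x 1 by exact: derivableB.
have Df : 'D_1 (u - v) x = - (w1 - w2).
  by rewrite deriveB// Du Dv opprB opprK addrC.
have /cvgrPdist_le/(_ _ eps0) : h^-1 *: ((u - v) (h + x) - (u - v) x) @[h --> 0^'] -->
    'D_1 (u - v) x.
  have -> : (fun h => h^-1 *: ((u - v) (h + x) - (u - v) x)) =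
      (fun h => h^-1 *: (((u - v) \o shift x) (h *: (1 : R^o)) - (u - v) x)).
    by apply/funext => h /=; rewrite [h *: _]mulr1.
  exact: df.
move=> /nbhs_ballP[r /= r0 fr]; near=> y.
have yx : y < x by near: y; exact: nbhs_left_lt.
have xy0 : 0 < x - y by rewrite subr_gt0.
have yx0 : y - x != 0 by rewrite subr_eq0 lt_eqF.
have := fr (y - x); rewrite Df subrK => fry.
(* Accretivity with parameter [x - y] leaves an error of [y - x] times the gap between derivative
   and difference quotient. *)
rewrite lerBlDl; apply: (le_trans (accA _ _ _ _ _ xy0 Aw1 Aw2)).
have -> : u x - v x + (x - y) *: (w1 - w2) =
    (u y - v y) + (y - x) *: (- (w1 - w2) - (y - x)^-1 *: ((u - v) y - (u - v) x)).
  rewrite [in RHS]scalerBr scalerA divff// scale1r scalerN -scaleNr opprB/=.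
  rewrite -[(u - v) y]/(u y - v y) -[(u - v) x]/(u x - v x).
  move: (u y - v y) (u x - v x) (_ *: _) => p q s.
  by rewrite opprB addrCA [p + _]addrC subrK addrC.
rewrite (le_trans (ler_normD _ _))// lerD2l normrZ distrC gtr0_norm// mulrC.
rewrite ler_pM2r// fry//=.
rewrite /ball/= sub0r normrN distrC gtr0_norm// ltrBlDl -ltrBlDr.
by near: y; apply: nbhs_left_gt; rewrite ltrBlDr ltrDl.
Unshelve. all: by end_near. Qed.

End accretive_paths.

(** * Countable separating families of functionals *)

Section separating_sequence.
Context (R : realType) (V : normedModType R) (Vs : set {linear V -> R^o}).

(** A Lindelof argument: for each ball with centre in the countable dense set and rational radius,
    one functional of [Vs] without zeros on it is kept, if there is any. [None] fills the other
    indices, all of them when [Vs] is empty. *)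
Lemma separating_sequence : separable V -> Vs `<=` @dual R V ->
  separates_points Vs ->
  exists psi : nat -> option {linear V -> R^o},
    (forall n Psi, psi n = Some Psi -> Vs Psi) /\
    forall v, (forall n Psi, psi n = Some Psi -> Psi v = 0) -> v = 0.
Proof.
move=> [S /countable_injP[f finj] dS] Vsd sep.
pose good (p : nat * rat) (Psi : {linear V -> R^o}) := Vs Psi /\
  exists s, [/\ S s, f s = p.1 & forall y, ball s (ratr p.2) y -> Psi y != 0].
pose psi (k : nat) : option {linear V -> R^o} :=
  if @unpickle (nat * rat)%type k is Some p then
    if pselect (exists Psi, good p Psi) is left e then Some (projT1 (cid e))
    else None
  else None.
exists psi; split => [k Psi|v psiv].
  rewrite /psi; case: unpickle => // p; case: pselect => // e [<-].
  by case: (cid e) => ? [].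
apply: contrapT => v0; apply: v0; apply: sep => Psi VsPsi.
apply: contrapT => /eqP Psiv.
have /nbhs_ballP[r /= r0 rPsi] : nbhs v [set y | Psi y != 0].
  apply: (Vsd _ VsPsi v [set y : R^o | y != 0]).
  by apply: open_nbhs_nbhs; split => //; exact: open_neq.
(* A radius below [r / 2] puts the ball around [s], which contains [v], inside the ball of radius
   [r] around [v]. *)
have [q qr q0] : exists2 q : rat, ratr q < r / 2 & 0 < ratr q :> R.
  have [q] := rat_in_itvoo (divr_gt0 r0 (ltr0n R 2)).
  by rewrite in_itv/= => /andP[? ?]; exists q.
have [s [vs Ss]] : ball v (ratr q) `&` S !=set0.
  apply: dS; first by exists v; exact: ballxx.
  exact: ball_open.
have e : exists Psi, good (f s, q) Psi.
  exists Psi; split => //; exists s; split => // y sy; apply: rPsi.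
  apply: (@le_ball _ _ _ (ratr q + ratr q)); last exact: ball_triangle vs sy.
  by rewrite [leRHS]splitr lerD// ltW.
have := psiv (pickle (f s, q)); rewrite /psi pickleK.
case: pselect => // e'; case: (cid e') => Phi [VsPhi [s' [Ss' /= fs' Phi0]]] /=.
move=> /(_ _ erefl) Phiv.
have ss' : s' = s by apply: finj => //; rewrite inE.
by have := Phi0 v; rewrite ss' Phiv eqxx => /(_ (ball_sym vs)).
Qed.

End separating_sequence.

(** * Strong solutions along one trajectory *)

Section strong_paths.
Context (R : realType) (V : normedModType R) (A : V -> set V) (A0 : V -> V).
Context (Vs : set {linear V -> R^o}) (a : nat -> R).
Implicit Types (u v : R -> V) (e : nat -> V).
Hypothesis (a0 : a 0%N = 0) (a_incr : forall m, a m < a m.+1).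

(* A trajectory of a strong solution whose jump at [a m.+1] is [e m]. *)
Definition strong_path e u :=
  [/\ cadlag u,
      forall t, 0 < t -> (forall m, t <> a m.+1) -> op_dom A (u t),
      forall m (c d : R), c <= d ->
        `[c, d]%classic `<=` `]a m, a m.+1[%classic -> W11 c d u,
      forall t Psi, 0 < t -> Vs Psi ->
        lebesgue_measure.-integrable `]0, t[ (fun s => (Psi (A0 (u s)))%:E) &
      forall n t Psi, 0 < t -> a n <= t < a n.+1 -> Vs Psi ->
        Psi (u t - u 0) + \int[lebesgue_measure]_(s in `]0, t[) Psi (A0 (u s)) =
        \sum_(m < n) Psi (e m)].

Lemma times_ge0 n : 0 <= a n.
Proof. by elim: n => [|n ih]; rewrite ?a0// (le_trans ih)// ltW. Qed.

(** Between two jumps the integral equation makes [Psi (u y)] a constant minus an integral, to which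
    Lebesgue differentiation applies. The exceptional null set depends on [Psi]. *)
Lemma weak_derivative n (Psi : {linear V -> R^o}) e u : Vs Psi -> continuous Psi ->
  strong_path e u ->
  {ae lebesgue_measure, forall s, a n < s < a n.+1 -> derivable u s 1 ->
     Psi ('D_1 u s) = - Psi (A0 (u s))}.
Proof.
move=> VsPsi cPsi [_ _ _ intu equ].
have an1 : 0 < a n.+1 by rewrite (le_lt_trans _ (a_incr n))// times_ge0.
pose f s : R := Psi (A0 (u s)).
(* The cut-off is integrable on the whole line and leaves the integrals up to [y < a n.+1]
   unchanged. *)
pose g := f \_ `]0, a n.+1[.
have intg : lebesgue_measure.-integrable setT (EFin \o g).
  rewrite /g -restrict_EFin; apply/integrable_restrict => //=.
  by rewrite setTI; exact: intu.
have locg : locally_integrable setT g by apply: open_integrable_locally => //; exact: openT.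
have intgS y : lebesgue_measure.-integrable `]0, y] (EFin \o g).
  exact: integrableS intg.
have := @FTC1 R g (BRight 0) intgS locg.
apply: filterS; first exact: (ae_filter_ringOfSetsType lebesgue_measure).
move=> s /= Fs /andP[ans san1] dus.
have s0 : 0 < s by rewrite (le_lt_trans _ ans)// times_ge0.
have [] := Fs; first by rewrite lte_fin.
set F := fun x : R => _.
have FE y : a n < y < a n.+1 -> F y = \int[lebesgue_measure]_(s in `]0, y[) f s.
  move=> /andP[any yan1]; have y0 : 0 < y by rewrite (le_lt_trans _ any)// times_ge0.
  rewrite Rintegral_itv_bndo_bndc; last exact: intu.
  apply: eq_Rintegral => x; rewrite inE/= in_itv/= => /andP[x0 xy].
  by rewrite /g patchE mem_set//= in_itv/= x0 (le_lt_trans xy).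
have PsiE y : a n < y < a n.+1 -> Psi (u y) = Psi (u 0) + \sum_(m < n) Psi (e m) - F y.
  move=> yI; rewrite FE//; have /andP[any yan1] := yI.
  have y0 : 0 < y by rewrite (le_lt_trans _ any)// times_ge0.
  rewrite -(equ n y Psi y0 _ VsPsi) ?(ltW any)// linearB/=.
  by rewrite addrA addrK subrKC.
move=> dF F's.
have -> : Psi (A0 (u s)) = 'D_1 F s.
  by rewrite -derive1E F's /g patchE mem_set//= in_itv/= s0.
(* The limit of this difference quotient is computed twice: by continuity of [Psi] and by the
   integral equation. *)
pose k (h : R) : R^o := h^-1 *: (Psi (u (h + s)) - Psi (u s)).
have k1 : k h @[h --> 0^'] --> Psi ('D_1 u s).
  have -> : k = Psi \o (fun h => h^-1 *: ((u \o shift s) (h *: (1 : R^o)) - u s)).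
    by apply/funext => h /=; rewrite [h *: 1]mulr1 linearZ/= linearB/=.
  exact: (cvg_comp _ _ dus (cPsi _)).
have k2 : k h @[h --> 0^'] --> - 'D_1 F s.
  have : - (h^-1 *: ((F \o shift s) (h *: (1 : R^o)) - F s)) @[h --> 0^'] --> - 'D_1 F s.
    by apply: cvgN; exact: dF.
  apply: cvg_trans; apply: near_eq_cvg; near=> h.
  have hI : a n < h + s < a n.+1.
    near: h; apply: nbhs_dnbhs.
    have hs : (h + s) @[h --> (0 : R)] --> s.
      by rewrite -[X in _ --> X]add0r; apply: cvgD => //; exact: cvg_cst.
    apply: (hs [set x | a n < x < a n.+1]).
    have : s \in `]a n, a n.+1[ by rewrite in_itv/= ans.
    by move=> /near_in_itvoo; apply: filterS => x; rewrite in_itv.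
  rewrite /= [h *: 1]mulr1 /k (PsiE _ hI) (PsiE s) ?ans//.
  rewrite -scalerN opprB; congr (_ *: _).
  by rewrite [RHS]addrC opprB addrA subrK.
exact: cvg_unique k1 k2.
Unshelve. all: by end_near. Qed.

(** The integral is continuous in its upper limit, so a jump of [Psi \o u] can only come from the
    sum, which gains the term [Psi (e n)] at [a n.+1]. *)
Lemma strong_path_jump n e u (l : V) : Vs `<=` @dual R V -> separates_points Vs ->
  strong_path e u -> u y @[y --> (a n.+1)^'-] --> l -> u (a n.+1) - l = e n.
Proof.
move=> Vsd sep [_ _ _ intu equ] ul; apply/eqP; rewrite -subr_eq0; apply/eqP.
apply: sep => Psi VsPsi.
set b := a n.+1 in ul *.
have anb : a n < b by exact: a_incr.
have b0 : 0 < b by rewrite (le_lt_trans _ anb)// times_ge0.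
pose f s : R := Psi (A0 (u s)).
pose g := f \_ `]0, b[.
have intg : lebesgue_measure.-integrable setT (EFin \o g).
  rewrite /g -restrict_EFin; apply/integrable_restrict => //=.
  by rewrite setTI; exact: intu.
have intgS (I : interval R) : lebesgue_measure.-integrable [set` I] (EFin \o g).
  exact: integrableS intg.
pose F y := parameterized_integral lebesgue_measure 0 y g.
have FE y : 0 < y -> y <= b -> F y = \int[lebesgue_measure]_(s in `]0, y[) f s.
  move=> y0 yb; rewrite /F /parameterized_integral.
  rewrite -Rintegral_itv_obnd_cbnd// -Rintegral_itv_bndo_bndc//.
  apply: eq_Rintegral => x; rewrite inE/= in_itv/= => /andP[x0 xy].
  by rewrite /g patchE mem_set//= in_itv/= x0 (lt_le_trans xy).
have Fb : F y @[y --> b^'-] --> F b.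
  exact: parameterized_integral_cvg_at_left.
pose K : R := Psi (u 0) + \sum_(m < n) Psi (e m).
have PsiE y : a n < y < b -> Psi (u y) = K - F y.
  move=> /andP[any yb]; have y0 : 0 < y by rewrite (le_lt_trans _ any)// times_ge0.
  rewrite FE// ?ltW// /K -(equ n y Psi y0 _ VsPsi) ?(ltW any)// linearB/=.
  by rewrite addrA addrK subrKC.
have Psib : Psi (u b) = K + Psi (e n) - F b.
  have := equ n.+1 b Psi b0 _ VsPsi; rewrite lexx a_incr => /(_ isT).
  rewrite big_ord_recr/= FE// /K -(addrA (Psi (u 0))) => <-.
  by rewrite linearB/= addrA addrK subrKC.
have P1 : (K - F y : R^o) @[y --> b^'-] --> Psi l.
  have : Psi (u y) @[y --> b^'-] --> Psi l.
    exact: (cvg_comp _ _ ul (Vsd _ VsPsi _)).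
  apply: cvg_trans; apply: near_eq_cvg; near=> y; rewrite -PsiE//.
  by apply/andP; split; near: y; [exact: nbhs_left_gt|exact: nbhs_left_lt].
have P2 : (K - F y : R^o) @[y --> b^'-] --> (K - F b : R^o).
  by apply: cvgB => //; exact: cvg_cst.
have Psil : Psi l = K - F b by exact: cvg_unique P1 P2.
by rewrite !linearB/= Psil Psib opprB addrA subrK [K + _]addrC addrK subrr.
Unshelve. all: by end_near. Qed.

(** Testing with a countable separating family keeps the union of the exceptional sets null and
    still identifies the vectors. *)
Lemma strong_path_derive n e u : separable V -> Vs `<=` @dual R V ->
  separates_points Vs -> strong_path e u ->
  {ae lebesgue_measure, forall s, a n < s < a n.+1 -> derivable u s 1 ->
     'D_1 u s = - A0 (u s)}.
Proof.
move=> sV Vsd sep pu; have [psi [Vspsi seppsi]] := separating_sequence sV Vsd sep.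
have : {ae lebesgue_measure, forall s, forall k Psi, psi k = Some Psi ->
    a n < s < a n.+1 -> derivable u s 1 -> Psi ('D_1 u s) = - Psi (A0 (u s))}.
  apply: ae_foralln => k; case: (psi k) (Vspsi k) => [Psi Vk|_]; last first.
    by exists set0; split => // x /= H; apply: H.
  have VPsi := Vk _ erefl.
  have := weak_derivative n VPsi (Vsd _ VPsi) pu.
  apply: filterS; first exact: (ae_filter_ringOfSetsType lebesgue_measure).
  by move=> s H _ [<-].
apply: filterS; first exact: (ae_filter_ringOfSetsType lebesgue_measure).
move=> s H sI us; apply/eqP; rewrite -subr_eq0 opprK; apply/eqP/seppsi => k Psi kPsi.
by rewrite linearD/= (H _ _ kPsi sI us) addNr.
Qed.

Hypotheses (sV : separable V) (Vsd : Vs `<=` @dual R V) (sep : separates_points Vs).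
Hypotheses (accA : accretive A) (A0A : forall x, op_dom A x -> A x (A0 x)).

Lemma strong_path_dom n e u s : strong_path e u -> a n < s < a n.+1 -> A (u s) (A0 (u s)).
Proof.
move=> [_ dom _ _ _] /andP[ans san]; apply: A0A; apply: dom.
  by rewrite (le_lt_trans _ ans)// times_ge0.
have mono : {homo a : i j / (i < j)%N >-> i < j} by exact: homo_ltn lt_trans a_incr.
have /ltW_homo mono' := mono.
move=> m sm; move: ans san; rewrite sm.
have [/mono'|/mono'] := leqP m.+1 n.
  by rewrite leNgt => /negP.
by rewrite leNgt => /negP.
Qed.

Lemma strong_path_dist_nonincreasing n e1 e2 u v (c d : R) :
  strong_path e1 u -> strong_path e2 v -> a n < c -> c <= d -> d < a n.+1 ->
  `|u d - v d| <= `|u c - v c|.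
Proof.
move=> pu pv anc cd dan.
have cdI : `[c, d]%classic `<=` `]a n, a n.+1[%classic.
  by move=> x /=; rewrite !in_itv/= => /andP[/(lt_le_trans anc)-> /le_lt_trans->].
have [acu du] : W11 c d u by case: pu => _ _ + _ _; apply; [exact: cd|exact: cdI].
have [acv dv] : W11 c d v by case: pv => _ _ + _ _; apply; [exact: cd|exact: cdI].
have [Du Dv] := (strong_path_derive n sV Vsd sep pu, strong_path_derive n sV Vsd sep pv).
(* The endpoint [d] joins the exceptional set, because differentiability is known only inside []c,
   d[] while the monotonicity criterion tests points up to [d]. *)
have Nd : lebesgue_measure.-negligible [set d].
  by exists [set d]; split => //; exact: lebesgue_measure_set1.
have := negligibleU (negligibleU (negligibleU du dv) (negligibleU Du Dv)) Nd.
move=> /(absolutely_continuous_nonincreasing cd (absolutely_continuous_dist acu acv)).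
apply => x /andP[cx xd] Nx eps eps0.
have {}xd : x < d.
  by rewrite lt_neqAle xd andbT; apply/eqP => xd'; apply: Nx; right.
have xI : a n < x < a n.+1 by rewrite (lt_trans anc cx) (lt_trans xd dan).
have ux : derivable u x 1.
  apply: contrapT => ux; apply: Nx; do 3 left; apply/not_implyP.
  by split => //; rewrite in_itv/= cx.
have vx : derivable v x 1.
  apply: contrapT => vx; apply: Nx; do 2 left; right; apply/not_implyP.
  by split => //; rewrite in_itv/= cx.
apply: (accretive_dist_left (w1 := A0 (u x)) (w2 := A0 (v x)) accA ux vx) => //.
- by apply: contrapT => H; apply: Nx; left; right; left => /(_ xI ux).
- by apply: contrapT => H; apply: Nx; left; right; right => /(_ xI vx).
- exact: strong_path_dom pu xI.
- exact: strong_path_dom pv xI.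
Qed.

(** Right continuity at [a n] extends the decrease on the open interval to its left endpoint. *)
Lemma strong_path_dist_le n e1 e2 u v (t : R) :
  strong_path e1 u -> strong_path e2 v -> a n <= t -> t < a n.+1 ->
  `|u t - v t| <= `|u (a n) - v (a n)|.
Proof.
move=> pu pv; rewrite le_eqVlt => /predU1P[->//|ant tan].
have [[ru _] _ _ _ _] := pu; have [[rv _] _ _ _ _] := pv.
have uv : `|u y - v y| @[y --> (a n)^'+] --> `|u (a n) - v (a n)|.
  by apply: cvg_norm; apply: cvgB; [apply: ru|apply: rv]; exact: times_ge0.
rewrite -(cvg_lim _ uv)//; apply: limr_ge; first by apply/cvg_ex; eexists; exact: uv.
near=> y; apply: (strong_path_dist_nonincreasing pu pv _ _ tan).
  by near: y; exact: nbhs_right_gt.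
by apply/ltW; near: y; exact: nbhs_right_lt.
Unshelve. all: by end_near. Qed.

(** With left limits [l] and [k], the difference after the jump is [(l - k) + (e1 n - e2 n)], and
    the norm of [l - k] inherits the bound valid before the jump. *)
Lemma strong_path_jump_dist n e1 e2 u v :
  strong_path e1 u -> strong_path e2 v ->
  `|u (a n.+1) - v (a n.+1)| <= `|u (a n) - v (a n)| + `|e1 n - e2 n|.
Proof.
move=> pu pv; have an0 : 0 < a n.+1 by rewrite (le_lt_trans (times_ge0 n)).
have [[_ lu] _ _ _ _] := pu; have [[_ lv] _ _ _ _] := pv.
have /cvg_ex[l ul] := lu _ an0; have /cvg_ex[k vk] := lv _ an0.
have <- := strong_path_jump Vsd sep pu ul; have <- := strong_path_jump Vsd sep pv vk.
have lk : `|l - k| <= `|u (a n) - v (a n)|.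
  have uv : `|u y - v y| @[y --> (a n.+1)^'-] --> `|l - k|.
    by apply: cvg_norm; exact: cvgB.
  rewrite -(cvg_lim _ uv)//; apply: limr_le; first by apply/cvg_ex; eexists; exact: uv.
  near=> y; apply: (strong_path_dist_le pu pv).
    by near: y; exact: nbhs_left_ge.
  by near: y; exact: nbhs_left_lt.
apply: le_trans (lerD lk (lexx _)); apply: le_trans (ler_normD _ _).
by rewrite [- (v _ - k)]opprB addrACA [l + _]addrC subrK addKr.
Unshelve. all: by end_near. Qed.

Lemma strong_path_contraction n e1 e2 u v (t : R) :
  strong_path e1 u -> strong_path e2 v -> a n <= t -> t < a n.+1 ->
  `|u t - v t| <= `|u 0 - v 0| + \sum_(m < n) `|e1 m - e2 m|.
Proof.
move=> pu pv ant tan; apply: le_trans (strong_path_dist_le pu pv ant tan) _.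
elim: n {ant tan} => [|n ih]; first by rewrite a0 big_ord0 addr0.
apply: le_trans (strong_path_jump_dist n pu pv) _.
by rewrite big_ord_recr/= addrA lerD2r.
Qed.

End strong_paths.

(** * Measurability of distances in a separable space *)

Lemma countable_bigcup_measurable d (T : sigmaRingType d) (I : Type) (S : set I)
    (F : I -> set T) : countable S -> (forall i, S i -> measurable (F i)) ->
  measurable (\bigcup_(i in S) F i).
Proof.
move=> /countable_injP[f finj] mF.
have -> : \bigcup_(i in S) F i =
    \bigcup_k \bigcup_(i in [set i | S i /\ f i = k]) F i.
  apply/seteqP; split => x.
    by move=> [i Si Fx]; exists (f i) => //; exists i.
  by move=> [k _ [i [Si _] Fx]]; exists i.
apply: bigcupT_measurable => k.
have [[i [Si fik]]|nS] := pselect (exists i, S i /\ f i = k).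
  rewrite (_ : [set _ | _] = [set i]) ?bigcup_set1; first exact: mF.
  apply/seteqP; split => [j [Sj fj]|_ ->//].
  by apply: finj; rewrite ?inE// fik.
by rewrite bigcup0// => i Si; exfalso; apply: nS; exists i.
Qed.

Section borel_functions.
Context (R : realType) (V : normedModType R).

Lemma continuous_borel_measurable (f : V -> R) : continuous f ->
  measurable_fun setT (f : borel V -> R).
Proof.
move=> cf mT; apply: (measurability _ (RGenOpens.measurableE R)) => //.
move=> _ [_ [x [y ->] <-]]; rewrite setTI; apply: sub_sigma_algebra.
by apply: open_comp; [move=> ? _; exact: cf|exact: interval_open].
Qed.

Context d (T : measurableType d) (D : set T).

Lemma measurable_fun_dist_cst (f : T -> V) (s : V) :
  measurable_fun D (f : T -> borel V) -> measurable_fun D (fun x => `|f x - s|).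
Proof.
move=> mf; pose h (x : V) := `|x - s|.
have mh : measurable_fun setT (h : borel V -> R).
  apply: continuous_borel_measurable => x.
  by apply: cvg_norm; apply: cvgB; [exact: cvg_id|exact: cvg_cst].
exact: (measurable_comp measurableT (@subsetT _ _) mh mf).
Qed.

(** The bound [|f x - g x| < r] is witnessed by a point [s] of the dense set and a rational [q]
    splitting [r], which gives countable unions of sets involving [f] and [g] separately. *)
Lemma measurable_fun_dist (f g : T -> V) : separable V ->
  measurable_fun D (f : T -> borel V) -> measurable_fun D (g : T -> borel V) ->
  measurable_fun D (fun x => `|f x - g x|).
Proof.
move=> [S cS dS] mf mg mD; apply: (measurability _ (RGenInftyO.measurableE R)) => //.
move=> _ [_ [r ->] <-].
rewrite [X in measurable X](_ : _ = \bigcup_(s in S) \bigcup_(q : rat)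
  ((D `&` (fun x => `|f x - s|) @^-1` `]-oo, ratr q[%classic) `&`
   (D `&` (fun x => `|g x - s|) @^-1` `]-oo, r - ratr q[%classic))).
  apply: countable_bigcup_measurable => // s _.
  apply: bigcupT_measurable_rat => q; apply: measurableI.
    by apply: measurable_fun_dist_cst mf mD _ _; exact: measurable_itv.
  by apply: measurable_fun_dist_cst mg mD _ _; exact: measurable_itv.
apply/seteqP; split => x /=.
  (* With [e] half of the gap, [|f x - s| < q < e] forces [|g x - s| < r - q]. *)
  rewrite in_itv/= => -[Dx fgr]; pose e := (r - `|f x - g x|) / 2.
  have e0 : 0 < e by rewrite divr_gt0// subr_gt0.
  have [s [fs Ss]] : ball (f x) e `&` S !=set0.
    apply: dS; first by exists (f x); exact: ballxx.
    exact: ball_open.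
  move: fs; rewrite -ball_normE/= => fs.
  exists s => //; have [q] := rat_in_itvoo fs; rewrite in_itv/= => /andP[fsq qe].
  exists q => //=; rewrite !in_itv/=; split; split => //.
  have := ler_distD (f x) (g x) s; rewrite [`|g x - f x|]distrC.
  have : e * 2 = r - `|f x - g x| by rewrite /e divfK.
  by move: fsq qe; lra.
move=> [s Ss [q _ [[Dx]]]]; rewrite !in_itv/= => fs [_ gs]; split => //.
have := ler_distD s (f x) (g x); rewrite [`|s - g x|]distrC.
move: fs gs; rewrite !in_itv/=; lra.
Qed.

End borel_functions.

(** * Integrals against the counting measure as finite sums *)

Section point_function_integral.
Context (R : realType) (dZ : measure_display) (Z : measurableType dZ).
Context (theta : point_function R Z) (a : nat -> R) (z : nat -> Z).
Hypotheses (a0 : a 0%N = 0) (a_incr : forall m, a m < a m.+1).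
Hypothesis (a_dom : pf_dom theta = [set a m.+1 | m in [set: nat]]).
Hypothesis (a_z : forall m, theta (a m.+1) = Some (z m)).

Lemma hitting_mono : {homo a : i j / (i <= j)%N >-> i <= j}.
Proof. by apply: ltW_homo; apply: homo_ltn a_incr; exact: lt_trans. Qed.

Lemma hitting_mono_lt : {homo a : i j / (i < j)%N >-> i < j}.
Proof. by apply: homo_ltn a_incr; exact: lt_trans. Qed.

Section hitting_interval.
Context (n : nat) (t : R).
Hypotheses (ant : a n <= t) (tan : t < a n.+1).

Let D : set (R * Z) := `]0, t] `*` setT.

Let mD : measurable D.
Proof. by apply: measurableX => //; exact: measurable_itv. Qed.

Let Dq m : (m < n)%N -> D (a m.+1, z m).
Proof.
move=> mn; split => //=; rewrite in_itv/= (le_trans (hitting_mono mn))// andbT.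
by rewrite -a0; exact: hitting_mono_lt.
Qed.

(** Exactly the times [a 1, ..., a n] of the domain fall in []0, t]], and they are distinct, so each
    point contributes one Dirac mass. *)
Lemma pf_count_dirac (U : set (R * Z)) : measurable U -> U `<=` D ->
  pf_count theta U = msum (fun m => \d_(a m.+1, z m)) n U.
Proof.
move=> mU UD; rewrite /pf_count /msum/=.
pose F m : set R := if `[< U (a m.+1, z m) >] then [set a m.+1] else set0.
have mF m : measurable (F m) by rewrite /F; case: ifP => _; [exact: measurable_set1|].
have -> : pf_times theta U = \big[setU/set0]_(m < n) F m.
  rewrite -bigcup_mkord; apply/seteqP; split => s.
    move=> [y thetas Us].
    have : pf_dom theta s by rewrite /pf_dom/= thetas.
    rewrite a_dom => -[m _ sm].
    have yz : y = z m by move: thetas; rewrite -sm a_z => -[].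
    exists m => /=; last by rewrite /F sm -yz asboolT.
    have [/=] := UD _ Us; rewrite in_itv/= => /andP[_ st] _.
    rewrite ltnNge; apply/negP => nm.
    have := lt_le_trans tan (hitting_mono (leq_ltn_trans nm (ltnSn m))).
    by rewrite sm ltNge st.
  move=> [m /= mn]; rewrite /F; case: asboolP => // Um ->.
  by exists (z m) => //; rewrite a_z.
rewrite (@measure_semi_additive_ord_I _ _ R counting)//; last 2 first.
  move=> i j _ _ [s []]; rewrite /F; case: ifP => // _ ->; case: ifP => // _ /= /eqP.
  have [ij|ij|//] := ltngtP i j.
    by rewrite lt_eqF// hitting_mono_lt.
  by rewrite gt_eqF// hitting_mono_lt.
  exact: bigsetU_measurable.
apply: eq_bigr => m _; rewrite /F diracE.
have [Um|Um] := pselect (U (a m.+1, z m)).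
  rewrite (asboolT Um) mem_set//= /counting.
  by rewrite asboolT//= fset_set1 finmap.cardfs1.
by rewrite (asboolF Um) memNset//= measure0.
Qed.

Lemma ge0_integral_pf_count (f : R * Z -> \bar R) : measurable_fun D f ->
  (forall q, D q -> 0 <= f q)%E ->
  (\int[pf_count theta]_(q in D) f q = \sum_(m < n) f (a m.+1, z m))%E.
Proof.
move=> mf f0; rewrite (eq_measure_integral (msum (fun m => \d_(a m.+1, z m)) n)); last first.
  by move=> U mU UD; exact: pf_count_dirac.
rewrite ge0_integral_measure_sum//; apply: eq_bigr => m _.
by rewrite integral_dirac// diracE mem_set ?mul1e//; exact: Dq.
Qed.

Lemma integral_pf_count (f : R * Z -> R) : measurable_fun D f ->
  (\int[pf_count theta]_(q in D) (f q)%:E = (\sum_(m < n) f (a m.+1, z m))%:E)%E.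
Proof.
move=> mf; have mf' : measurable_fun D (EFin \o f) by exact/measurable_EFinP.
rewrite integralE ge0_integral_pf_count//; last exact/measurable_funepos.
rewrite ge0_integral_pf_count//; last exact/measurable_funeneg.
(* Positive and negative parts of a real number are finite, so the two sums may be subtracted
   termwise. *)
rewrite -sumeN; last first.
  by move=> i j _ _; rewrite !funenegE/= !EFinN -!EFin_max fin_num_adde_defl.
rewrite -big_split/= -sumEFin; apply: eq_bigr => m _.
by rewrite [RHS](congr1 (@^~ (a m.+1, z m)) (funeposneg (EFin \o f))).
Qed.

End hitting_interval.

(** If no [a n] exceeded [t], the infinite domain would lie in []0, t]] and have infinite count. The
    least [n] with [t < a n] is positive because [a 0 = 0 <= t]. *)
Lemma hitting_interval_exists (t : R) : infinite_set (pf_dom theta) ->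
  (pf_count theta (`]0%R, t] `*` setT) < +oo)%E -> 0 <= t ->
  exists n, a n <= t < a n.+1.
Proof.
move=> inf fin t0.
have [n tn] : exists n, t < a n.
  apply: contrapT => /forallNP tn; apply/inf.
  have -> : pf_dom theta = pf_times theta (`]0, t] `*` setT).
    apply/seteqP; split => [s|s [y sy _]]; last by rewrite /pf_dom/= sy.
    rewrite a_dom => -[m _ <-]; exists (z m) => //; split => //=.
    rewrite in_itv/= -[X in X < _]a0 hitting_mono_lt//=.
    by rewrite leNgt; apply/negP; exact: tn.
  apply: contrapT => /asboolPn H; move: fin; rewrite /pf_count /counting.
  by rewrite (negbTE H).
have ex : exists n, t < a n by exists n.
case: (ex_minnP ex) => -[|m] tm mmin.
  by move: tm; rewrite a0 ltNge t0.
by exists m; rewrite tm andbT leNgt; apply/negP => /mmin; rewrite ltnn.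
Qed.

End point_function_integral.

(** * Almost sure finiteness of the counts *)

Section finite_point_processes.
Context (R : realType) (dO : measure_display) (Omega : measurableType dO).
Context (P : probability Omega R) (dZ : measure_display) (Z : measurableType dZ).
Variable Theta : Omega -> point_function R Z.

Lemma pf_count_fin_or_infty (theta : point_function R Z) U :
  (exists k : nat, pf_count theta U = k%:R%:E) \/ pf_count theta U = +oo%E.
Proof.
rewrite /pf_count/= /counting; case: ifPn => _; last by right.
by left; eexists.
Qed.

(** The sigma-algebra on point functions supplies the level sets of finite counts; the level [+oo]
    is the complement of their union, and every preimage is a countable union of levels. *)
Lemma measurable_pf_count (U : set (R * Z)) : point_process Theta ->
  measurable U -> U `<=` `]0, +oo[%classic `*` setT ->
  measurable_fun setT (fun w => pf_count (Theta w) U).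
Proof.
move=> mTheta mU U0 _ Y mY; rewrite setTI.
have mk (k : nat) : measurable [set w | pf_count (Theta w) U = k%:R%:E].
  rewrite -[X in measurable X]setTI.
  apply: (mTheta measurableT [set theta | pf_count theta U = k%:R%:E]).
  by apply: sub_sigma_algebra; exists k, U.
have moo : measurable [set w | pf_count (Theta w) U = +oo%E].
  rewrite (_ : [set _ | _] = ~` \bigcup_k [set w | pf_count (Theta w) U = k%:R%:E]).
    by apply: measurableC; exact: bigcupT_measurable.
  apply/seteqP; split => w /=.
    by move=> woo [k _ /=]; rewrite woo.
  by move=> H; have [[k wk]|//] := pf_count_fin_or_infty (Theta w) U; case: H; exists k.
pose F k := if k%:R%:E \in Y then [set w | pf_count (Theta w) U = k%:R%:E] else set0.
pose G := if +oo%E \in Y then [set w | pf_count (Theta w) U = +oo%E] else set0.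
rewrite (_ : _ @^-1` _ = \bigcup_k F k `|` G).
  apply: measurableU; first by apply: bigcupT_measurable => k; rewrite /F; case: ifP.
  by rewrite /G; case: ifP.
apply/seteqP; split => w.
  rewrite /preimage/= => Yw; have [[k wk]|woo] := pf_count_fin_or_infty (Theta w) U.
    by left; exists k => //; rewrite /F mem_set// -wk.
  by right; rewrite /G mem_set// -woo.
rewrite /preimage/= => -[[k _]|]; rewrite /F /G; case: ifPn => // + /= ->;
  by rewrite inE.
Qed.

(** Finite expectation gives almost sure finiteness for each integer horizon, hence for all of them
    together; monotonicity covers real [t]. *)
Lemma finite_point_process_ae : finite_point_process P Theta ->
  {ae P, forall w (t : R), (pf_count (Theta w) (`]0%R, t] `*` setT) < +oo)%E}.
Proof.
move=> [mTheta fin].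
have : {ae P, forall w (k : nat),
    pf_count (Theta w) (`]0%R, k.+1%:R] `*` setT) \is a fin_num}.
  apply: ae_foralln => k.
  have mk : measurable_fun setT (fun w => pf_count (Theta w) (`]0%R, k.+1%:R] `*` setT)).
    apply: measurable_pf_count => //.
      by apply: measurableX => //; exact: measurable_itv.
    by move=> [s y] [/=]; rewrite !in_itv/= andbT => /andP[].
  have ik : P.-integrable setT (fun w => pf_count (Theta w) (`]0%R, k.+1%:R] `*` setT)).
    apply/integrableP; split => //.
    under eq_integral do rewrite gee0_abs//.
    exact: fin.
  by have := integrable_ae measurableT ik; apply: filterS => w; apply.
apply: filterS => w H t; have [k tk] : exists k : nat, t <= k.+1%:R.
  exists (Num.truncn `|t|); apply: le_trans (ler_norm _) _.
  by rewrite ltW// truncnS_gt.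
apply: (@le_lt_trans _ _ (pf_count (Theta w) (`]0%R, k.+1%:R] `*` setT))); last first.
  by rewrite -ge0_fin_numE.
apply: le_measure; rewrite ?inE; [by apply: measurableX => //; exact: measurable_itv..|].
move=> [s y] [/=]; rewrite !in_itv/= => /andP[s0 st] _; split => //=.
by rewrite s0 (le_trans st).
Qed.

End finite_point_processes.

(** * From solutions of the stochastic equation to trajectories with jumps *)

Lemma measurable_noise_section (R : realType) (V : completeNormedModType R)
    (dO dZ : measure_display) (Omega : measurableType dO) (Z : measurableType dZ)
    (eta : R -> Z -> Omega -> V) (w : Omega) (t : R) : measurable_noise eta ->
  measurable_fun (`]0, t] `*` setT : set (R * Z))
    ((fun q => eta q.1 q.2 w) : R * Z -> borel V).
Proof.
move=> meta.
pose g (q : R * Z) : R * Z * Omega := (q, w).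
have mF : measurable (`]0, +oo[ `*` setT `*` setT : set (R * Z * Omega)).
  by apply: measurableX => //; apply: measurableX => //; exact: measurable_itv.
have mg : measurable_fun (`]0, t] `*` setT) g.
  by apply: measurable_funTS; exact: measurable_fun_pair.
apply: (measurable_comp mF _ meta mg).
move=> _ [[s y] /= [+ _] <-]; rewrite in_itv/= => /andP[s0 _].
by do 2 split => //=; rewrite in_itv/= s0.
Qed.

Section solution_paths.
Context (R : realType) (dZ : measure_display) (Z : measurableType dZ).
Context (dO : measure_display) (Omega : measurableType dO).
Context (V : completeNormedModType R) (A : V -> set V) (A0 : V -> V).
Context (Vs : set {linear V -> R^o}) (Theta : Omega -> point_function R Z).
Context (alpha : nat -> Omega -> R) (w : Omega) (z : nat -> Z).
Implicit Types (x : Omega -> V) (eta : R -> Z -> Omega -> V) (X : R -> Omega -> V).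
Hypotheses (a0 : alpha 0%N w = 0) (a_incr : forall m, alpha m w < alpha m.+1 w).
Hypothesis (a_dom : pf_dom (Theta w) = [set alpha m.+1 w | m in [set: nat]]).
Hypothesis (a_z : forall m, Theta w (alpha m.+1 w) = Some (z m)).
Hypotheses (sV : separable V) (Vsd : Vs `<=` @dual R V).

Let jump eta m := eta (alpha m.+1 w) (z m) w.

(** The noise integral becomes the finite sum of the jumps up to [t]; the drift integral is finite,
    so the equation between extended reals reduces to one between reals. *)
Lemma strong_solution_path x eta X : measurable_noise eta ->
  solution_path alpha A x X w ->
  (forall t Psi, 0 < t -> Vs Psi ->
     lebesgue_measure.-integrable `]0, t[ (fun s => (Psi (A0 (X s w)))%:E)) ->
  (forall t Psi, 0 < t -> Vs Psi ->
     ((Psi (X t w - x w))%:E +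
        \int[lebesgue_measure]_(s in `]0%R, t[) (Psi (A0 (X s w)))%:E =
      \int[pf_count (Theta w)]_(q in `]0%R, t] `*` setT)
        (Psi (eta q.1 q.2 w))%:E)%E) ->
  strong_path A A0 Vs (alpha ^~ w) (jump eta) (X ^~ w).
Proof.
move=> meta [X0 rcll dom w11] int eqn; split => //.
move=> n t Psi t0 /andP[ant tan] VsPsi; rewrite X0.
have mPsi : measurable_fun (`]0, t] `*` setT : set (R * Z))
    (fun q => Psi (eta q.1 q.2 w) : R).
  have mP := continuous_borel_measurable (Vsd VsPsi).
  exact: (measurable_comp measurableT (@subsetT _ _) mP
    (measurable_noise_section w meta)).
have := eqn t Psi t0 VsPsi.
rewrite (integral_pf_count a0 a_incr a_dom a_z ant tan mPsi).
rewrite -[(\int[_]_(_ in _) _)%E]fineK; first by rewrite -EFinD => -[].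
exact: integrable_fin_num (int _ _ t0 VsPsi).
Qed.

Lemma noise_dist_integral eta1 eta2 n t : measurable_noise eta1 ->
  measurable_noise eta2 -> alpha n w <= t -> t < alpha n.+1 w ->
  (\int[pf_count (Theta w)]_(q in `]0%R, t] `*` setT)
     `|eta1 q.1 q.2 w - eta2 q.1 q.2 w|%:E =
   (\sum_(m < n) `|jump eta1 m - jump eta2 m|)%:E)%E.
Proof.
move=> meta1 meta2 ant tan.
apply: (integral_pf_count a0 a_incr a_dom a_z ant tan
  (f := fun q => `|eta1 q.1 q.2 w - eta2 q.1 q.2 w|)).
apply: measurable_fun_dist => //; exact: measurable_noise_section.
Qed.

End solution_paths.

(** * Passage to the limit for mild solutions *)

Lemma cvg0_lt (R : realType) (u : nat -> \bar R) (e : R) :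
  u @ \oo --> 0%E -> 0 < e -> \forall k \near \oo, (u k < e%:E)%E.
Proof.
move=> u0 e0; apply: (u0 [set y | (y < e%:E)%E]).
by apply: open_nbhs_nbhs; split; [exact: open_ereal_lt_ereal|rewrite /= lte_fin].
Qed.

Unset Implicit Arguments.

Theorem theorem0p3p3 (R : realType)
  (dO : measure_display) (Omega : measurableType dO) (P : probability Omega R)
  (dZ : measure_display) (Z : measurableType dZ)
  (Theta : Omega -> point_function R Z) (alpha : nat -> Omega -> R)
  (V : completeNormedModType R)
  (A : V -> set V) (T : R -> V -> V) (A0 : V -> V)
  (Vs : set {linear V -> R^o})
  (eta1 eta2 : R -> Z -> Omega -> V) (x1 x2 : Omega -> V)
  (X1 X2 : R -> Omega -> V)
  (P_complete : measure_is_complete P)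
  (Theta_finite : finite_point_process P Theta)
  (Theta_infinite : {ae P, forall w, infinite_set (pf_dom (Theta w))})
  (alpha_hitting : hitting_times P Theta alpha)
  (V_separable : separable V)
  (A_m_accretive : m_accretive A)
  (A_dense : densely_defined A)
  (T_semigroup : associated_semigroup A T)
  (T_invariant : domain_invariant A T)
  (A0_generator : infinitesimal_generator A T A0)
  (Vs_dual : Vs `<=` @dual R V)
  (Vs_separates : separates_points Vs)
  (eta1_measurable : measurable_noise eta1)
  (eta2_measurable : measurable_noise eta2)
  (x1_measurable : measurable_initial x1)
  (x2_measurable : measurable_initial x2)
  (X1_mild : ACPRM_mild_solution P Theta alpha A A0 Vs x1 eta1 X1)
  (X2_mild : ACPRM_mild_solution P Theta alpha A A0 Vs x2 eta2 X2) :
  {ae P, forall w (t : R), 0 <= t ->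
    (`|X1 t w - X2 t w|%:E <=
     `|x1 w - x2 w|%:E +
     \int[pf_count (Theta w)]_(q in `]0%R, t] `*` setT)
       `|eta1 q.1 q.2 w - eta2 q.1 q.2 w|%:E)%E}.
Proof.
have [alpha0 _ _ alpha_ae] := alpha_hitting.
have [accA _] := A_m_accretive.
have A0A v : op_dom A v -> A v (A0 v) by move=> /(A0_generator.1 v)[].
have [_ sol1 [xs1 [etas1 [Xs1 [_ metas1 strong1 cvg1]]]]] := X1_mild.
have [_ sol2 [xs2 [etas2 [Xs2 [_ metas2 strong2 cvg2]]]]] := X2_mild.
have str1 := ae_foralln (fun k => (strong1 k).2).
have str2 := ae_foralln (fun k => (strong2 k).2).
have fin := finite_point_process_ae Theta_finite.
have aeP : Filter (nbhs (almost_everywhere P)) by exact: ae_filter_ringOfSetsType.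
have aeI Q1 Q2 : {ae P, forall w, Q1 w} -> {ae P, forall w, Q2 w} ->
    {ae P, forall w, Q1 w /\ Q2 w} by exact: filterI.
(* One set of full measure serves all approximation indices, so the rest of the argument takes place
   at a fixed [w]. *)
have H := aeI _ _ (aeI _ _ (aeI _ _ Theta_infinite alpha_ae)
    (aeI _ _ fin (aeI _ _ sol1 sol2)))
  (aeI _ _ (aeI _ _ str1 str2) (aeI _ _ cvg1 cvg2)).
apply: filterS H => w [[[inf [dom incr]] [finw [[X10 _ _ _] [X20 _ _ _]]]]
  [[st1 st2] [c1 c2]]] t.
(* The approximation is given for positive times only; at time 0 both paths equal their initial
   values. *)
rewrite le_eqVlt => /predU1P[<-|t0].
  by rewrite X10 X20 leeDl// integral_ge0.
have /choice[z az] : forall m, exists y, Theta w (alpha m.+1 w) = Some y.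
  move=> m; have : pf_dom (Theta w) (alpha m.+1 w) by rewrite dom; exists m.
  by rewrite /pf_dom/=; case: (Theta w _) => // y _; exists y.
have a0 := alpha0 w.
have [n /andP[ant tan]] :=
  hitting_interval_exists a0 incr dom az inf (finw t) (ltW t0).
have distE eta eta' (meta : measurable_noise eta) (meta' : measurable_noise eta') :=
  noise_dist_integral a0 incr dom az V_separable meta meta' ant tan.
rewrite distE// -EFinD lee_fin -X10 -X20.
have [C1 I1] := c1 t t0; have [C2 I2] := c2 t t0.
have sup_lt (Xs : nat -> R -> Omega -> V) (X : R -> Omega -> V) k e s :
    (ereal_sup [set `|Xs k s w - X s w|%:E | s in `[0%R, t]] < e%:E)%E ->
    0 <= s <= t -> `|Xs k s w - X s w| < e.
  move=> lte st; rewrite -lte_fin; apply: le_lt_trans lte.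
  by apply: ereal_sup_ubound; exists s => //=; rewrite in_itv.
(* Six errors occur: two paths at time [t], two at time 0, and two noise sums. *)
apply/ler_addgt0Pr => e e0; have e6 : 0 < e / 6 by rewrite divr_gt0.
have [k [[S1 S2] [J1 J2]]] := filter_ex (filterI
  (filterI (cvg0_lt C1 e6) (cvg0_lt C2 e6))
  (filterI (cvg0_lt I1 e6) (cvg0_lt I2 e6))).
move: J1 J2; rewrite !distE// !lte_fin.
have [sol1k int1 eq1] := st1 k; have [sol2k int2 eq2] := st2 k.
have p1 := strong_solution_path a0 incr dom az Vs_dual (metas1 k) sol1k int1 eq1.
have p2 := strong_solution_path a0 incr dom az Vs_dual (metas2 k) sol2k int2 eq2.
have := strong_path_contraction a0 incr V_separable Vs_dual Vs_separates
  accA A0A p1 p2 ant tan.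
have tt : 0 <= t <= t by apply/andP; split; [exact: ltW|exact: lexx].
(* The supremum over [[0, t]] includes time 0 and so controls the initial values of the
   approximations as well. *)
have t00 : (0 : R) <= (0 : R) <= t by apply/andP; split; [exact: lexx|exact: ltW].
have S1t := sup_lt _ _ _ _ _ S1 tt; have S2t := sup_lt _ _ _ _ _ S2 tt.
have S10 := sup_lt _ _ _ _ _ S1 t00; have S20 := sup_lt _ _ _ _ _ S2 t00.
have quad (p q p' q' : V) : `|p - q| <= `|p - p'| + `|p' - q'| + `|q - q'|.
  rewrite [`|q - q'|]distrC; apply: le_trans (ler_distD q' _ _) _.
  by rewrite lerD2r ler_distD.
have quad_sum (p q p' q' : nat -> V) :
    \sum_(m < n) `|p m - q m| <= \sum_(m < n) `|p m - p' m| +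
      \sum_(m < n) `|p' m - q' m| + \sum_(m < n) `|q m - q' m|.
  by rewrite -!big_split/=; apply: ler_sum => m _; exact: quad.
have := quad (X1 t w) (X2 t w) (Xs1 k t w) (Xs2 k t w).
rewrite [`|X1 t w - Xs1 _ _ _|]distrC [`|X2 t w - Xs2 _ _ _|]distrC.
have := quad (Xs1 k 0 w) (Xs2 k 0 w) (X1 0 w) (X2 0 w).
have := quad_sum (fun m => etas1 k (alpha m.+1 w) (z m) w)
  (fun m => etas2 k (alpha m.+1 w) (z m) w)
  (fun m => eta1 (alpha m.+1 w) (z m) w) (fun m => eta2 (alpha m.+1 w) (z m) w).
lra.
Qed.
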